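(* Let $d, n \ge 1$ be integers, let $\alpha_1,\dots,\alpha_d \in \mathbb{R}\setminus\{0\}$ and $\beta_1,\dots,\beta_d \in \mathbb{R}$, and let $f : [-1,1]^d \times \mathbb{R}^{d+1} \to \mathbb{R}$ be the generic quadratic model $$f(x,\theta) = \theta_0 + \sum_{k=1}^d \alpha_k \theta_k x_k + \sum_{k=1}^d \beta_k \frac{\theta_k^2}{2} x_k^2, \qquad \theta = (\theta_0,\theta_1,\dots,\theta_d).$$ Let $\tilde{x} = (x_1,\dots,x_n)$ be a design with $x_i = (x_{i,1},\dots,x_{i,d}) \in \{-1,1\}^d$ for all $i \in \{1,\dots,n\}$, $\sum_{i=1}^n x_i = 0$, and $\sum_{i=1}^n x_{i,k} x_{i,l} = n\,\delta_{k,l}$ for all $k,l \in \{1,\dots,d\}$. Then for every $\tilde{y} = (y_1,\dots,y_n) \in \mathbb{R}^n$ there exists a unique least-squares estimator $\hat{\theta}_f(\tilde{x},\tilde{y}) = (\hat{\theta}_0, \hat{\theta}_1,\dots,\hat{\theta}_d)$ for $f$ based on $(\tilde{x},\tilde{y})$, and it is given by $$\hat{\theta}_0 = \frac{1}{n}\sum_{i=1}^n y_i - \sum_{k=1}^d \frac{\beta_k}{2\alpha_k^2 n^2}\Big(\sum_{i=1}^n x_{i,k} y_i\Big)^2, \qquad \hat{\theta}_k = \frac{1}{\alpha_k n}\sum_{i=1}^n x_{i,k} y_i \quad (k \in \{1,\dots,d\}).$$ Additionally, for every $x = (x^{(1)},\dots,x^{(d)}) \in [-1,1]^d$ the estimated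 model is given by $$f\big(x,\hat{\theta}_f(\tilde{x},\tilde{y})\big) = \frac{1}{n}\sum_{i=1}^n y_i + \sum_{k=1}^d \frac{1}{n}\Big(\sum_{i=1}^n x_{i,k} y_i\Big) x^{(k)} + \sum_{k=1}^d \frac{\beta_k}{2\alpha_k^2 n^2}\Big(\sum_{i=1}^n x_{i,k} y_i\Big)^2 \big((x^{(k)})^2 - 1\big).$$
   Context: A least-squares estimator for $f$ based on $(\tilde{x},\tilde{y})$ is a minimizer over $\theta \in \mathbb{R}^{d+1}$ of $S_{\tilde{x},\tilde{y}}(\theta) = \sum_{i=1}^n (y_i - f(x_i,\theta))^2$. $\delta_{k,l}$ is the Kronecker delta. In the definition of $f$, $x_k$ denotes the $k$th component of $x \in [-1,1]^d$; design points are $x_i$ with components $x_{i,k}$, and $x^{(k)}$ is the $k$th component of the input point $x$. *)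

(* Defs.v *)
From HB Require Import structures.
From mathcomp Require Import all_boot all_order all_algebra.
From mathcomp Require Import reals.

Set Implicit Arguments.
Unset Strict Implicit.
Unset Printing Implicit Defensive.

Import Order.TTheory GRing.Theory Num.Theory.
Local Open Scope ring_scope.

Definition cube (R : realType) (d : nat) (x : 'rV[R]_d) : Prop :=
  forall k : 'I_d, -1 <= x 0 k <= 1.

(* The parameter theta = (theta_0, ..., theta_d) is a row vector of length d+1:
   theta_0 is its entry at index 0, and theta_(k+1) its entry at lift ord0 k
   for k : 'I_d, while x, alpha and beta are indexed by 'I_d from 0.
   As a model on [-1,1]^d this function is only meant on the cube; the same
   formula defines it on all row vectors. *)
Definition quad_model (R : realType) (d : nat) (alpha beta : 'I_d -> R)
    (x : 'rV[R]_d) (theta : 'rV[R]_d.+1) : R :=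
  theta 0 ord0
  + \sum_(k < d) alpha k * theta 0 (lift ord0 k) * x 0 k
  + \sum_(k < d) beta k * (theta 0 (lift ord0 k) ^+ 2 / 2) * x 0 k ^+ 2.

Definition sum_sq_residuals (R : realType) (d p n : nat)
    (f : 'rV[R]_d -> 'rV[R]_p -> R) (x : 'I_n -> 'rV[R]_d) (y : 'I_n -> R)
    (theta : 'rV[R]_p) : R :=
  \sum_(i < n) (y i - f (x i) theta) ^+ 2.

Definition least_squares_estimator (R : realType) (d p n : nat)
    (f : 'rV[R]_d -> 'rV[R]_p -> R) (x : 'I_n -> 'rV[R]_d) (y : 'I_n -> R)
    (theta : 'rV[R]_p) : Prop :=
  forall theta' : 'rV[R]_p,
    sum_sq_residuals f x y theta <= sum_sq_residuals f x y theta'.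

(* Main.v *)
(* Since x_ik^2 = 1 on the design points, the model restricted to the design is
   the linear model c + sum_k b_k x_ik in the coordinates
   c = theta_0 + sum_k beta_k theta_k^2 / 2 and b_k = alpha_k theta_k, which
   determine theta.  The design being centred and orthogonal, the residual sum
   of squares is a constant plus n times the squared distance of (c, b) to the
   linear least-squares coefficients, so it has exactly one minimizer. *)

Require Import Defs.
From HB Require Import structures.
From mathcomp Require Import all_boot all_order all_algebra.
From mathcomp Require Import reals ring.

Set Implicit Arguments.
Unset Strict Implicit.
Unset Printing Implicit Defensive.

Import Order.TTheory GRing.Theory Num.Theory.
Local Open Scope ring_scope.

Section LinearFit.

Variables (R : realType) (d n : nat) (x : 'I_n -> 'rV[R]_d).

Definition linear_fit (c : R) (b : 'I_d -> R) (i : 'I_n) : R :=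
  c + \sum_(k < d) b k * x i 0 k.

(** No assumption on the design enters yet: this is only an exchange of sums. Taking [g] to be 1, a
    design coordinate, the fit itself or [y] yields every inner product used below. *)
Lemma sum_mul_linear_fit (g : 'I_n -> R) c b :
  \sum_(i < n) g i * linear_fit c b i =
  c * \sum_(i < n) g i + \sum_(k < d) b k * \sum_(i < n) x i 0 k * g i.
Proof.
under eq_bigr do rewrite mulrDr mulr_sumr.
rewrite big_split /= exchange_big /= mulr_sumr; congr (_ + _).
  by apply: eq_bigr => i _; rewrite mulrC.
by apply: eq_bigr => k _; rewrite mulr_sumr; apply: eq_bigr => i _; ring.
Qed.

Hypothesis n_gt0 : (0 < n)%N.
Hypothesis x_centred : \sum_(i < n) x i = 0.
Hypothesis x_orthogonal : forall k l : 'I_d,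
  \sum_(i < n) x i 0 k * x i 0 l = n%:R * (k == l)%:R.

Let nR_neq0 : n%:R != 0 :> R.
Proof. by rewrite pnatr_eq0 -lt0n. Qed.

Lemma sum_design_coord k : \sum_(i < n) x i 0 k = 0.
Proof. by rewrite -summxE x_centred mxE. Qed.

Lemma sum_linear_fit c b : \sum_(i < n) linear_fit c b i = n%:R * c.
Proof.
rewrite -(eq_bigr _ (fun i _ => mul1r (linear_fit c b i))).
rewrite sum_mul_linear_fit sumr_const card_ord mulrC big1 ?addr0 // => k _.
under eq_bigr do rewrite mulr1.
by rewrite sum_design_coord mulr0.
Qed.

Lemma sum_coord_mul_linear_fit c b k :
  \sum_(i < n) x i 0 k * linear_fit c b i = n%:R * b k.
Proof.
rewrite sum_mul_linear_fit sum_design_coord mulr0 add0r (bigD1 k) //=.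
rewrite x_orthogonal eqxx mulr1 big1 ?addr0 1?mulrC // => l /negPf neq_lk.
by rewrite x_orthogonal neq_lk !mulr0.
Qed.

(** Parseval's identity: the constant column and the [d] coordinate columns are pairwise orthogonal,
    each of squared norm [n]. *)
Lemma sum_sqr_linear_fit c b :
  \sum_(i < n) linear_fit c b i ^+ 2 =
  n%:R * (c ^+ 2 + \sum_(k < d) b k ^+ 2).
Proof.
under eq_bigr do rewrite expr2.
rewrite sum_mul_linear_fit sum_linear_fit mulrDr mulr_sumr.
congr (_ + _); first by ring.
by apply: eq_bigr => k _; rewrite sum_coord_mul_linear_fit; ring.
Qed.

Variable y : 'I_n -> R.

(** The Gram matrix of the columns is [n] times the identity, so the normal equations are solved by
    dividing by [n]. *)
Definition ols_intercept : R := n%:R^-1 * \sum_(i < n) y i.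

Definition ols_slope (k : 'I_d) : R :=
  n%:R^-1 * \sum_(i < n) x i 0 k * y i.

(** Completing the square: after expansion, [y] enters the terms that depend on [(c, b)] only
    through its inner products with the columns, which are [n] times the OLS coefficients. *)
Lemma sum_sqr_residual_linear_fit c b :
  \sum_(i < n) (y i - linear_fit c b i) ^+ 2 =
  \sum_(i < n) (y i - linear_fit ols_intercept ols_slope i) ^+ 2
  + n%:R * ((c - ols_intercept) ^+ 2
            + \sum_(k < d) (b k - ols_slope k) ^+ 2).
Proof.
have sumyE c' b' : \sum_(i < n) y i * linear_fit c' b' i =
    n%:R * (c' * ols_intercept + \sum_(k < d) b' k * ols_slope k).
  rewrite sum_mul_linear_fit [RHS]mulrDr [X in _ = _ + X]mulr_sumr /ols_intercept.
  congr (_ + _); first by field.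
  by apply: eq_bigr => k _; rewrite /ols_slope; field.
have ssrE c' b' : \sum_(i < n) (y i - linear_fit c' b' i) ^+ 2 =
    \sum_(i < n) y i ^+ 2
    - 2 * \sum_(i < n) y i * linear_fit c' b' i
    + \sum_(i < n) linear_fit c' b' i ^+ 2.
  rewrite mulr_sumr -sumrB -big_split /=.
  by apply: eq_bigr => i _; ring.
rewrite !ssrE !sumyE !sum_sqr_linear_fit.
(* For [ring] each sum is an atom, so both sides are brought to the same three sums over [k]: of
   [b k ^+ 2], of [b k * ols_slope k] and of [ols_slope k ^+ 2]. *)
have -> : \sum_(k < d) (b k - ols_slope k) ^+ 2 =
    \sum_(k < d) b k ^+ 2 - 2 * \sum_(k < d) b k * ols_slope k
    + \sum_(k < d) ols_slope k ^+ 2.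
  by rewrite mulr_sumr -sumrB -big_split /=; apply: eq_bigr => k _; ring.
have -> : \sum_(k < d) ols_slope k * ols_slope k = \sum_(k < d) ols_slope k ^+ 2.
  by apply: eq_bigr => k _; rewrite expr2.
ring.
Qed.

(** The excess over the OLS residual is [n] times a sum of squares. If it is not positive, then, as
    [n] is positive, every square vanishes. *)
Lemma linear_fit_le_ols c b :
  \sum_(i < n) (y i - linear_fit c b i) ^+ 2 <=
    \sum_(i < n) (y i - linear_fit ols_intercept ols_slope i) ^+ 2 ->
  c = ols_intercept /\ b =1 ols_slope.
Proof.
rewrite sum_sqr_residual_linear_fit gerDl pmulr_rle0 ?ltr0n // => dist_le0.
have slope_ge0 : 0 <= \sum_(k < d) (b k - ols_slope k) ^+ 2.
  by apply: sumr_ge0 => k _; exact: sqr_ge0.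
have : (c - ols_intercept) ^+ 2 + \sum_(k < d) (b k - ols_slope k) ^+ 2 == 0.
  by rewrite eq_le dist_le0 addr_ge0 // sqr_ge0.
rewrite paddr_eq0 ?sqr_ge0 // sqrf_eq0 subr_eq0 => /andP[/eqP -> slope_eq0].
split=> // k; move: slope_eq0; rewrite psumr_eq0 => [|l _]; last exact: sqr_ge0.
by move=> /allP/(_ k (mem_index_enum k)); rewrite /= sqrf_eq0 subr_eq0 => /eqP.
Qed.

Lemma ols_le_linear_fit c b :
  \sum_(i < n) (y i - linear_fit ols_intercept ols_slope i) ^+ 2 <=
    \sum_(i < n) (y i - linear_fit c b i) ^+ 2.
Proof.
rewrite (sum_sqr_residual_linear_fit c b) lerDl mulr_ge0 ?ler0n //.
by rewrite addr_ge0 ?sqr_ge0 ?sumr_ge0 // => k _; exact: sqr_ge0.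
Qed.

End LinearFit.

Lemma quad_model_sign_design (R : realType) (d n : nat)
    (alpha beta : 'I_d -> R) (x : 'I_n -> 'rV[R]_d)
    (hx : forall i k, x i 0 k = -1 \/ x i 0 k = 1) (theta : 'rV[R]_d.+1) i :
  quad_model alpha beta (x i) theta =
  linear_fit x
    (theta 0 ord0 + \sum_(k < d) beta k * (theta 0 (lift ord0 k) ^+ 2 / 2))
    (fun k => alpha k * theta 0 (lift ord0 k)) i.
Proof.
rewrite /quad_model /linear_fit addrAC; congr (_ + _ + _).
apply: eq_bigr => k _.
by case: (hx i k) => ->; rewrite ?sqrrN expr1n mulr1.
Qed.

Theorem lemma1 (R : realType) (d n : nat) (hd : (1 <= d)%N) (hn : (1 <= n)%N)
    (alpha beta : 'I_d -> R) (halpha : forall k : 'I_d, alpha k <> 0)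
    (x : 'I_n -> 'rV[R]_d)
    (hx : forall (i : 'I_n) (k : 'I_d), x i 0 k = -1 \/ x i 0 k = 1)
    (hsum : \sum_(i < n) x i = 0)
    (horth : forall k l : 'I_d,
      \sum_(i < n) x i 0 k * x i 0 l = n%:R * (k == l)%:R)
    (y : 'I_n -> R) :
  exists theta : 'rV[R]_d.+1,
    [/\ unique (least_squares_estimator (quad_model alpha beta) x y) theta,
        theta 0 ord0 =
          n%:R^-1 * \sum_(i < n) y i
          - \sum_(k < d) beta k / (2 * alpha k ^+ 2 * n%:R ^+ 2)
                         * (\sum_(i < n) x i 0 k * y i) ^+ 2,
        forall k : 'I_d,
          theta 0 (lift ord0 k) =
            (alpha k * n%:R)^-1 * \sum_(i < n) x i 0 k * y i
      & forall z : 'rV[R]_d, cube z ->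
          quad_model alpha beta z theta =
            n%:R^-1 * \sum_(i < n) y i
            + \sum_(k < d) n%:R^-1 * (\sum_(i < n) x i 0 k * y i) * z 0 k
            + \sum_(k < d) beta k / (2 * alpha k ^+ 2 * n%:R ^+ 2)
                           * (\sum_(i < n) x i 0 k * y i) ^+ 2
                           * (z 0 k ^+ 2 - 1)].
Proof.
have n_neq0 : n%:R != 0 :> R by rewrite pnatr_eq0 -lt0n.
have alpha_neq0 k : alpha k != 0 by apply/eqP.
(* The witness solves [alpha k * theta_k = ols_slope x y k] first; the intercept equation then gives
   [theta_0], because its quadratic correction involves the slopes only. *)
pose slope k := (alpha k)^-1 * ols_slope x y k.
pose intercept :=
  ols_intercept y - \sum_(k < d) beta k * (slope k ^+ 2 / 2).
pose theta : 'rV[R]_d.+1 :=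
  \row_j oapp slope intercept (unlift ord0 j).
have theta0 : theta 0 ord0 = intercept by rewrite mxE unlift_none.
have thetaS k : theta 0 (lift ord0 k) = slope k by rewrite mxE liftK.
have alpha_slope k : alpha k * slope k = ols_slope x y k.
  by rewrite /slope mulVKf.
have ssrE t : sum_sq_residuals (quad_model alpha beta) x y t =
    \sum_(i < n) (y i - linear_fit x
      (t 0 ord0 + \sum_(k < d) beta k * (t 0 (lift ord0 k) ^+ 2 / 2))
      (fun k => alpha k * t 0 (lift ord0 k)) i) ^+ 2.
  by apply: eq_bigr => i _; rewrite quad_model_sign_design.
have ssr_theta : sum_sq_residuals (quad_model alpha beta) x y theta =
    \sum_(i < n)
      (y i - linear_fit x (ols_intercept y) (ols_slope x y) i) ^+ 2.
  rewrite ssrE theta0; under [X in intercept + X]eq_bigr do rewrite thetaS.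
  apply: eq_bigr => i _; rewrite subrK /linear_fit.
  by under eq_bigr do rewrite thetaS alpha_slope.
have quad_slope k : beta k * (slope k ^+ 2 / 2) =
    beta k / (2 * alpha k ^+ 2 * n%:R ^+ 2)
    * (\sum_(i < n) x i 0 k * y i) ^+ 2.
  by rewrite /slope /ols_slope; field; rewrite n_neq0 alpha_neq0.
exists theta; split.
- split=> [t|t t_min]; first by rewrite ssr_theta ssrE ols_le_linear_fit.
  have := t_min theta; rewrite ssr_theta ssrE.
  (* A minimizer [t] does at least as well as [theta], so its linear coefficients are the OLS ones;
     inverting the change of coordinates recovers [t], slopes first. *)
  move=> /(linear_fit_le_ols hn hsum horth)[t_intercept t_slope].
  have tS k : t 0 (lift ord0 k) = slope k.
    by rewrite /slope -t_slope mulKf.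
  apply/rowP => j; case: (unliftP ord0 j) => [k ->|->].
    by rewrite thetaS tS.
  rewrite theta0 /intercept -t_intercept.
  by under [X in _ - X]eq_bigr do rewrite -tS; rewrite addrK.
- by rewrite theta0 /intercept; under eq_bigr do rewrite quad_slope.
- by move=> k; rewrite thetaS /slope /ols_slope invfM mulrA.
- move=> z _; rewrite /quad_model theta0 /intercept.
  under [X in _ + X + _]eq_bigr do rewrite thetaS alpha_slope.
  (* The correction subtracted in the intercept is paired with the quadratic sum, which produces the
     factor [z 0 k ^+ 2 - 1]. *)
  rewrite -!addrA; congr (_ + _); rewrite addrCA; congr (_ + _).
  rewrite addrC -sumrB; apply: eq_bigr => k _.
  by rewrite thetaS -quad_slope; ring.
Qed.
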